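(* Let $d\ge 2$, $\beta\in\mathbb{R}$ and $A>0$. There exists a constant $C>0$, depending only on $d$, $\beta$ and $A$, such that for every odd prime power $q$ and every set $E\subset\mathbb{F}_q^d$ satisfying $$|\sigma_E^2(m)|\le A\,q^{-\beta}\qquad\text{for all } m\in\mathbb{F}_q^d,$$ one has $$\#\Delta(E)\ \ge\ C\,\min\left\{q,\ \frac{(\#E)^3}{q^{2d-\beta}}\right\}.$$
   Context: $\mathbb{F}_q$ is the finite field with $q$ elements. For $x\in\mathbb{F}_q^d$, $|x|^2=x_1^2+\dots+x_d^2\in\mathbb{F}_q$, and $\Delta(E)=\{|x-y|^2: x,y\in E\}\subset\mathbb{F}_q$. Fix a nontrivial additive character $\chi$ of $\mathbb{F}_q$ (for $q$ prime, $\chi(t)=e^{2\pi i t/q}$). Then $\widehat{E}(m)=q^{-d}\sum_{x\in E}\chi(-x\cdot m)$ for $m\in\mathbb{F}_q^d$, with $x\cdot m=\sum_j x_jm_j$, and $$\sigma_E^2(m)=\sum_{\{m'\in\mathbb{F}_q^d:\ |m'|^2=|m|^2\}}|\widehat{E}(m')|^2 .$$ *)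

(* Defs.v *)
From HB Require Import structures.
From mathcomp Require Import all_boot all_order all_algebra.
From mathcomp Require Import complex.
From mathcomp Require Import reals exp.

Set Implicit Arguments.
Unset Strict Implicit.
Unset Printing Implicit Defensive.

Import Order.TTheory GRing.Theory Num.Theory.
Local Open Scope ring_scope.

(* [Normc.normc : R[i] -> R] is the R-valued complex modulus. *)

Definition additive_character (R : realType) (F : finFieldType)
    (chi : F -> R[i]) : Prop :=
  {morph chi : s t / s + t >-> s * t} /\ forall t, Normc.normc (chi t) = 1.

Definition nontrivial_additive_character (R : realType) (F : finFieldType)
    (chi : F -> R[i]) : Prop :=
  additive_character chi /\ exists t, chi t <> 1.

Definition dot (F : finFieldType) (d : nat) (x y : 'rV[F]_d) : F :=
  \sum_(j < d) x 0 j * y 0 j.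

Definition sqnorm (F : finFieldType) (d : nat) (x : 'rV[F]_d) : F :=
  \sum_(j < d) x 0 j ^+ 2.

Definition distance_set (F : finFieldType) (d : nat) (E : {set 'rV[F]_d}) :
    {set F} :=
  [set sqnorm (x - y) | x in E, y in E].

Definition fourier (R : realType) (F : finFieldType) (chi : F -> R[i])
    (d : nat) (E : {set 'rV[F]_d}) (m : 'rV[F]_d) : R[i] :=
  (#|F|%:R ^+ d)^-1 * \sum_(x in E) chi (- dot x m).

Definition sigma2 (R : realType) (F : finFieldType) (chi : F -> R[i])
    (d : nat) (E : {set 'rV[F]_d}) (m : 'rV[F]_d) : R :=
  \sum_(m' : 'rV[F]_d | sqnorm m' == sqnorm m)
     Normc.normc (fourier chi E m') ^+ 2.

(* Main.v *)
Require Import Defs.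
From mathcomp Require Import all_boot all_order all_algebra.
From mathcomp Require Import fingroup cyclic.
From mathcomp Require Import complex ring.
From mathcomp Require Import reals exp.
Import Order.TTheory GRing.Theory Num.Theory.
Local Open Scope ring_scope.

(**
The proof is a second moment argument. Write q for the cardinality of the
field and nu(t) for the number of pairs (x, y) in E x E with |x - y|^2 = t
([pair_count]). The values nu(t), for t in the distance set, add up to |E|^2,
so Cauchy-Schwarz gives |E|^4 <= |Delta(E)| * sum_t nu(t)^2, and everything
rests on an upper bound for this sum of squares ([energy_le]).

Parseval on the field turns q * sum_t nu(t)^2 into sum_s |N(s)|^2, where
N(s) = sum_(x, y in E) chi(s |x - y|^2) ([distance_sum]). The term s = 0 is
|E|^4, the main term. For s <> 0, put s = -1/(4u). Let f(m) be the sum of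
chi(-x.m) over x in E, that is q^d times the Fourier coefficient of E at m.
Expanding |f(m)|^2 and completing the square in m gives
     sum_m |f(m)|^2 chi(u |m|^2) = N(s) * G(u),
where the quadratic Gauss sum G(u) in d variables has |G(u)|^2 = q^d
([sphere_mass_transform], [norm_gauss_sum]). The left-hand side depends on
|f|^2 only through its sums tau(r) over the spheres |m|^2 = r ([sphere_mass]):
it is the Fourier transform of tau at u. So a second use of Parseval on the
field, now for tau, gives
     q^d * sum_(s <> 0) |N(s)|^2 <= q * sum_r tau(r)^2,
and if tau <= B then
     sum_r tau(r)^2 <= B * sum_r tau(r) = B q^d |E|
by Parseval on the d-dimensional space. Altogether
     q * sum_t nu(t)^2 <= |E|^4 + q B |E|.

Since tau(|m|^2) = q^(2d) sigma_E^2(m), the hypothesis on sigma_E^2 allows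
B = A q^(2d - beta). Comparing each of the two terms on the right with the
minimum in the conclusion yields the constant C = 1/(1 + A).
*)

Set Implicit Arguments.
Unset Strict Implicit.

(** * Orthogonality and Parseval *)

Section Orthogonality.

Variable C : numClosedFieldType.

(** Translating the summation variable by some v with psi v <> 1 multiplies the
sum by psi v. *)
Lemma sum_character0 (V : finZmodType) (psi : V -> C) :
  {morph psi : u v / u + v >-> u * v} -> (exists v, psi v != 1) ->
  \sum_v psi v = 0.
Proof.
move=> psiD [v0 psi_v0]; set S := \sum_v psi v.
have SE : S = psi v0 * S.
  rewrite {1}/S (reindex_inj (addrI v0)) /= mulr_sumr.
  by apply: eq_bigr => v _; rewrite psiD.
have : (psi v0 - 1) * S == 0 by rewrite mulrBl mul1r -SE subrr.
by rewrite mulf_eq0 subr_eq0 (negbTE psi_v0) => /eqP.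
Qed.

(** Stated for an abstract orthogonal family [e] so that the same identity serves
the characters of the field, indexed by the field, and those of the space of
row vectors, indexed by that space. *)
Lemma parseval (V W : finType) (e : V -> W -> C) (N : C) (g : V -> C) :
  (forall v v', \sum_w e v w * (e v' w)^* = N * (v == v')%:R) ->
  \sum_w `|\sum_v g v * e v w| ^+ 2 = N * \sum_v `|g v| ^+ 2.
Proof.
move=> orth.
under eq_bigr => w _ do rewrite normCK rmorph_sum /= big_distrlr /=.
rewrite exchange_big /= mulr_sumr; apply: eq_bigr => v _.
rewrite exchange_big /= (bigD1 v) //= [X in _ + X]big1 ?addr0 => [|v' v'v].
  under eq_bigr => w _ do rewrite rmorphM /= mulrACA -normCK.
  by rewrite -mulr_sumr orth eqxx mulr1 mulrC.
under eq_bigr => w _ do rewrite rmorphM /= mulrACA.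
by rewrite -mulr_sumr orth eq_sym (negbTE v'v) !mulr0.
Qed.

End Orthogonality.

(** * The dot product and the quadratic form *)

Section DotProduct.

Variables (F : finFieldType) (d : nat).
Implicit Types x y z : 'rV[F]_d.

Lemma dotC x y : dot x y = dot y x.
Proof. by apply: eq_bigr => j _; rewrite mulrC. Qed.

Lemma dotDl x y z : dot (x + y) z = dot x z + dot y z.
Proof. by rewrite -big_split; apply: eq_bigr => j _; rewrite mxE mulrDl. Qed.

Lemma dotZl a x z : dot (a *: x) z = a * dot x z.
Proof. by rewrite mulr_sumr; apply: eq_bigr => j _; rewrite mxE mulrA. Qed.

Lemma dotNl x z : dot (- x) z = - dot x z.
Proof. by rewrite -scaleN1r dotZl mulN1r. Qed.

Lemma sqnormE x : sqnorm x = dot x x.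
Proof. by apply: eq_bigr => j _; rewrite expr2. Qed.

Lemma sqnormD x y : sqnorm (x + y) = sqnorm x + 2 * dot x y + sqnorm y.
Proof.
by rewrite !sqnormE dotDl !(dotC _ (x + y)) !dotDl (dotC y x); ring.
Qed.

Lemma sqnormZ a x : sqnorm (a *: x) = a ^+ 2 * sqnorm x.
Proof. by rewrite !sqnormE dotZl dotC dotZl mulrA expr2. Qed.

Lemma dot_nondegenerate x : x != 0 -> exists y, dot x y = 1.
Proof.
case/rV0Pn=> j xj; exists ((x 0 j)^-1 *: delta_mx 0 j).
rewrite dotC dotZl /dot (bigD1 j) //= !mxE !eqxx mul1r.
rewrite big1 ?addr0 ?mulVf // => k kj.
by rewrite mxE (negbTE kj) andbF mul0r.
Qed.

End DotProduct.

(** If 2 = 0 then 1 has additive order 2, which divides the order of the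
additive group. *)
Lemma finField_two_neq0 (F : finFieldType) : odd #|F| -> (2 : F) != 0.
Proof.
move=> oddF; apply/eqP=> two0.
have order2 : (#[1%R : F])%g = 2%N.
  apply: nt_prime_order => //; last exact: oner_neq0.
have := order_dvdG (in_setT (1%R : F)).
by rewrite order2 cardsT dvdn2 oddF.
Qed.

(** * The additive energy of distances *)

Section Energy.

Variables (F : finFieldType) (C : numClosedFieldType) (chi : F -> C).
Hypotheses (chiD : {morph chi : s t / s + t >-> s * t})
  (norm_chi : forall t, `|chi t| = 1) (chi_nontrivial : exists t, chi t != 1).

Local Notation q := (#|F|%:R : C).

Lemma chi0 : chi 0 = 1.
Proof.
have chi0_neq0 : chi 0 != 0 by rewrite -normr_eq0 norm_chi oner_neq0.
by apply: (mulIf chi0_neq0); rewrite -chiD addr0 mul1r.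
Qed.

Lemma chiN t : chi (- t) = (chi t)^*.
Proof.
have chit_neq0 : chi t != 0 by rewrite -normr_eq0 norm_chi oner_neq0.
apply: (mulfI chit_neq0).
by rewrite -chiD subrr chi0 -normCK norm_chi expr1n.
Qed.

Lemma sum_chi_mul a : \sum_t chi (a * t) = q * (a == 0)%:R.
Proof.
have [->|a_neq0] := eqVneq a 0.
  under eq_bigr => t _ do rewrite mul0r chi0.
  by rewrite sumr_const mulr1.
rewrite mulr0; apply: sum_character0 => [s t|]; first by rewrite mulrDr chiD.
have [t chit] := chi_nontrivial.
by exists (a^-1 * t); rewrite mulVKf.
Qed.

Lemma parseval_field (g : F -> C) :
  \sum_u `|\sum_r g r * chi (r * u)| ^+ 2 = q * \sum_r `|g r| ^+ 2.
Proof.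
apply: parseval => r r'; rewrite -subr_eq0 -sum_chi_mul.
by apply: eq_bigr => u _; rewrite mulrBl chiD chiN.
Qed.

Variable d : nat.
Implicit Types (x y z m : 'rV[F]_d) (E : {set 'rV[F]_d}).

Lemma sum_chi_dot z : \sum_m chi (dot z m) = q ^+ d * (z == 0)%:R.
Proof.
have [->|z_neq0] := eqVneq z 0.
  under eq_bigr => m _ do rewrite -(scale0r 0) dotZl mul0r chi0.
  by rewrite sumr_const card_mx mul1n natrX mulr1.
rewrite mulr0; apply: sum_character0 => [x y|].
  by rewrite dotC dotDl chiD !(dotC _ z).
have [t chit] := chi_nontrivial; have [y zy] := dot_nondegenerate z_neq0.
by exists (t *: y); rewrite dotC dotZl dotC zy mulr1.
Qed.

Definition gauss_sum (u : F) : C := \sum_(m : 'rV[F]_d) chi (u * sqnorm m).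

(** The Fourier transform of the indicator of [E], without the normalisation
q^(-d). *)
Definition exp_sum E m : C := \sum_(x in E) chi (- dot x m).

(** Up to the factor q^(2d) this is sigma_E^2, but indexed by the radius: it also
makes sense, and vanishes, at radii that no vector has. *)
Definition sphere_mass E (r : F) : C :=
  \sum_(m : 'rV[F]_d | sqnorm m == r) `|exp_sum E m| ^+ 2.

Lemma sphere_mass_ge0 E r : 0 <= sphere_mass E r.
Proof. by apply: sumr_ge0 => m _; rewrite exprn_ge0. Qed.

(** The spheres partition the space, so this is Parseval for the indicator of
[E]. *)
Lemma sum_sphere_mass E : \sum_r sphere_mass E r = q ^+ d * #|E|%:R.
Proof.
transitivity (\sum_m `|exp_sum E m| ^+ 2).
  by rewrite [RHS](partition_big (@sqnorm F d) xpredT).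
under eq_bigr => m _ do rewrite /exp_sum big_mkcond /=.
have -> : (#|E|%:R : C) = \sum_x `|(x \in E)%:R : C| ^+ 2.
  rewrite -sum1_card natr_sum big_mkcond; apply: eq_bigr => x _.
  by case: (x \in E); rewrite ?normr1 ?normr0 ?expr1n ?expr0n.
rewrite -(parseval (e := fun x m => chi (- dot x m))).
  apply: eq_bigr => m _; congr (`|_| ^+ 2); apply: eq_bigr => x _.
  by case: (x \in E); rewrite ?mul1r ?mul0r.
move=> x y; rewrite -subr_eq0 -oppr_eq0 opprB -sum_chi_dot.
by apply: eq_bigr => m _; rewrite -chiN opprK -chiD dotDl dotNl addrC.
Qed.

(** The Fourier transform of the counting function of the distances, as
[distance_sumE] shows. *)
Definition distance_sum E (s : F) : C :=
  \sum_(x in E) \sum_(y in E) chi (s * sqnorm (x - y)).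

Definition pair_count E (t : F) : nat :=
  (\sum_(x in E) \sum_(y in E) (sqnorm (x - y) == t))%N.

Lemma distance_sumE E s :
  distance_sum E s = \sum_t (pair_count E t)%:R * chi (t * s).
Proof.
under [RHS]eq_bigr => t _ do rewrite natr_sum mulr_suml.
rewrite exchange_big /=; apply: eq_bigr => x _.
under [RHS]eq_bigr => t _ do rewrite natr_sum mulr_suml.
rewrite exchange_big /=; apply: eq_bigr => y _.
rewrite (bigD1 (sqnorm (x - y))) //= eqxx mul1r mulrC.
by rewrite big1 ?addr0 // => t /negbTE; rewrite eq_sym => ->; rewrite mul0r.
Qed.

Lemma distance_sum0 E : distance_sum E 0 = #|E|%:R ^+ 2.
Proof.
rewrite /distance_sum.
under eq_bigr => x _ do under eq_bigr => y _ do rewrite mul0r chi0.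
by rewrite !sumr_const -[_ *+ #|E|]mulr_natl expr2.
Qed.

Hypothesis two_neq0 : (2 : F) != 0.

Lemma four_neq0 : (4 : F) != 0.
Proof.
have -> : (4 : F) = 2 * 2 by ring.
by rewrite mulf_neq0.
Qed.

(** Substituting a = b + h in the double sum for |G(u)|^2, the difference
|b + h|^2 - |b|^2 is affine in b, and the sum over b vanishes unless h = 0. *)
Lemma norm_gauss_sum u : u != 0 -> `|gauss_sum u| ^+ 2 = q ^+ d.
Proof.
move=> u_neq0; rewrite normCK rmorph_sum /= big_distrlr /= exchange_big /=.
under eq_bigr => b _ do rewrite (reindex_inj (addIr b)) /=.
rewrite exchange_big /=.
transitivity (\sum_(h : 'rV[F]_d)
  chi (u * sqnorm h) * \sum_b chi (dot ((2 * u) *: h) b)).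
  apply: eq_bigr => h _; rewrite mulr_sumr; apply: eq_bigr => b _.
  by rewrite -chiN -!chiD sqnormD dotZl; congr chi; ring.
rewrite (bigD1 0) //= [X in _ + X]big1 => [|h h_neq0].
  rewrite sum_chi_dot scaler0 eqxx mulr1 addr0.
  by rewrite -(scale0r 0) sqnormZ expr0n mul0r mulr0 chi0 mul1r.
by rewrite sum_chi_dot scaler_eq0 (negbTE h_neq0) !mulf_eq0 (negbTE two_neq0)
  (negbTE u_neq0) !mulr0.
Qed.

(** Completing the square: the shift m - z/(2u) removes the linear term. *)
Lemma sum_chi_quadratic z u : u != 0 ->
  \sum_m chi (dot z m + u * sqnorm m)
    = chi (- (4 * u)^-1 * sqnorm z) * gauss_sum u.
Proof.
move=> u_neq0.
rewrite (reindex_inj (addIr (- (2 * u)^-1 *: z))) mulr_sumr /=.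
apply: eq_bigr => m _; rewrite -chiD; congr chi.
rewrite sqnormD sqnormZ (dotC m) (dotC z) dotDl !dotZl.
rewrite -sqnormE (dotC z m).
by field; rewrite two_neq0 u_neq0 four_neq0.
Qed.

Lemma norm_sqr_exp_sum E m :
  `|exp_sum E m| ^+ 2 = \sum_(x in E) \sum_(y in E) chi (dot (x - y) m).
Proof.
rewrite normCK rmorph_sum /= big_distrlr /= exchange_big /=.
apply: eq_bigr => x _; apply: eq_bigr => y _.
by rewrite -chiN opprK -chiD dotDl dotNl addrC.
Qed.

(** The link between the two sides: the Fourier transform of the sphere masses is
that of the distance counts, at the reciprocal frequency -1/(4u), up to a
factor whose modulus does not depend on u. *)
Lemma sphere_mass_transform E u : u != 0 ->
  \sum_r sphere_mass E r * chi (r * u)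
    = distance_sum E (- (4 * u)^-1) * gauss_sum u.
Proof.
move=> u_neq0.
transitivity (\sum_m `|exp_sum E m| ^+ 2 * chi (u * sqnorm m)).
  rewrite [RHS](partition_big (@sqnorm F d) xpredT) //=; apply: eq_bigr => r _.
  rewrite mulr_suml; apply: eq_bigr => m /eqP <-.
  by rewrite [u * _]mulrC.
under eq_bigr => m _ do rewrite norm_sqr_exp_sum mulr_suml.
rewrite exchange_big mulr_suml /=; apply: eq_bigr => x _.
under eq_bigr => m _ do rewrite mulr_suml.
rewrite exchange_big mulr_suml /=; apply: eq_bigr => y _.
by rewrite -sum_chi_quadratic //; apply: eq_bigr => m _; rewrite chiD.
Qed.

(** The frequencies -1/(4u) run over the nonzero elements of the field when u
does, so [sphere_mass_transform] can be squared and summed over u. Parseval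
gives equality once the frequency u = 0 is added on the side of the sphere
masses; that term is nonnegative. *)
Lemma sum_norm_distance_sum E :
  q ^+ d * \sum_(s | s != 0) `|distance_sum E s| ^+ 2
    <= q * \sum_r sphere_mass E r ^+ 2.
Proof.
pose h (u : F) := - (4 * u)^-1.
(* At u = 0 this uses the convention 0^-1 = 0. *)
have hK : involutive h.
  move=> u; have [->|u0] := eqVneq u 0.
    by rewrite /h !(mulr0, invr0, oppr0).
  by rewrite /h; field; rewrite u0 four_neq0 oppr_eq0 oner_neq0.
rewrite (reindex_inj (inv_inj hK)) /=.
have -> : \sum_r sphere_mass E r ^+ 2 = \sum_r `|sphere_mass E r| ^+ 2.
  by apply: eq_bigr => r _; rewrite ger0_norm ?sphere_mass_ge0.
rewrite -parseval_field [leRHS](bigD1 0) //= -[leLHS]add0r.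
apply: lerD; first exact: exprn_ge0.
have h_neq0 u : (h u != 0) = (u != 0).
  by rewrite /h oppr_eq0 invr_eq0 mulf_eq0 (negbTE four_neq0).
under eq_bigl => u do rewrite h_neq0.
rewrite mulr_sumr; apply: ler_sum => u u_neq0.
by rewrite sphere_mass_transform // normrM exprMn norm_gauss_sum // mulrC.
Qed.

Lemma energy_le E (B : C) : (forall r, sphere_mass E r <= B) ->
  q * \sum_t (pair_count E t)%:R ^+ 2 <= #|E|%:R ^+ 4 + q * B * #|E|%:R.
Proof.
move=> massB.
have q_gt0 : 0 < q by rewrite ltr0n; apply/card_gt0P; exists 0.
have -> : \sum_t ((pair_count E t)%:R : C) ^+ 2
    = \sum_t `|(pair_count E t)%:R : C| ^+ 2.
  by apply: eq_bigr => t _; rewrite normr_nat.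
rewrite -parseval_field (bigD1 0) //=.
have -> : `|\sum_t (pair_count E t)%:R * chi (t * 0)| ^+ 2 = #|E|%:R ^+ 4.
  (* The zero frequency gives the main term. *)
  by rewrite -distance_sumE distance_sum0 normrX normr_nat -exprM.
rewrite lerD2l.
under eq_bigr => s _ do rewrite -distance_sumE.
rewrite -(ler_pM2l (exprn_gt0 d q_gt0)).
apply: le_trans (sum_norm_distance_sum E) _.
(* One factor tau(r) is bounded by B; the other sums to q^d |E|. *)
have -> : q ^+ d * (q * B * #|E|%:R) = q * (B * (q ^+ d * #|E|%:R)) by ring.
rewrite ler_pM2l // -sum_sphere_mass mulr_sumr.
apply: ler_sum => r _.
by rewrite expr2 ler_wpM2r ?sphere_mass_ge0.
Qed.

Lemma sum_pair_count E :
  (\sum_(t in distance_set E) pair_count E t = #|E| ^ 2)%N.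
Proof.
rewrite exchange_big /= -mulnn -sum_nat_const; apply: eq_bigr => x xE.
rewrite exchange_big /= -sum1_card; apply: eq_bigr => y yE.
rewrite (bigD1 (sqnorm (x - y))) /=; last exact: imset2_f.
by rewrite eqxx big1 ?addn0 // => t /andP[_ /negbTE]; rewrite eq_sym => ->.
Qed.

End Energy.

(** Cauchy-Schwarz against the constant 1, by summing 2 f(i) f(j) <= f(i)^2 +
f(j)^2 over all pairs. *)
Lemma sqr_sum_le (I : finType) (A : {set I}) (f : I -> nat) :
  ((\sum_(i in A) f i) ^ 2 <= #|A| * \sum_(i in A) f i ^ 2)%N.
Proof.
rewrite -(leq_pmul2l (isT : 0 < 2)%N) -mulnn big_distrlr /= big_distrr /=.
have -> : (2 * (#|A| * \sum_(i in A) f i ^ 2)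
    = \sum_(i in A) \sum_(j in A) (f i ^ 2 + f j ^ 2))%N.
  under [RHS]eq_bigr => i _ do rewrite big_split /= sum_nat_const.
  by rewrite big_split /= sum_nat_const -big_distrr /= addnn mul2n.
apply: leq_sum => i _; rewrite big_distrr /=; apply: leq_sum => j _.
by rewrite nat_Cauchy.
Qed.

(** * The lower bound for the distance set *)

Lemma card_distance_set_ge (F : finFieldType) (C : numClosedFieldType)
    (chi : F -> C) (d : nat) (E : {set 'rV[F]_d}) (B : C) :
  {morph chi : s t / s + t >-> s * t} -> (forall t, `|chi t| = 1) ->
  (exists t, chi t != 1) -> odd #|F| ->
  (forall r, sphere_mass chi E r <= B) ->
  #|F|%:R * #|E|%:R ^+ 4
    <= #|distance_set E|%:R * (#|E|%:R ^+ 4 + #|F|%:R * B * #|E|%:R).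
Proof.
move=> chiD norm_chi chi_nontrivial oddF massB.
have two_neq0 := finField_two_neq0 oddF.
have le_energy := energy_le chiD norm_chi chi_nontrivial two_neq0 massB.
apply: le_trans (ler_wpM2l (ler0n C _) le_energy).
rewrite [leRHS]mulrCA; apply: ler_wpM2l; rewrite ?ler0n // -natrX.
rewrite (expnM _ 2 2) -sum_pair_count.
apply: le_trans (_ : (#|distance_set E| * \sum_t pair_count E t ^ 2)%:R <= _).
  rewrite ler_nat; apply: leq_trans (sqr_sum_le _ _) _.
  rewrite leq_mul2l; apply/orP; right.
  by rewrite [leqRHS](bigID (mem (distance_set E))) leq_addr.
by rewrite natrM natr_sum; under eq_bigr => t _ do rewrite natrX.
Qed.

(** The norm of [R[i]] as a numeric closed field and the real-valued modulus of
the statement agree by conversion. *)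
Lemma complex_normE (R : realType) (z : R[i]) :
  `|z| = (Normc.normc z)%:C%C.
Proof. by []. Qed.

Lemma sphere_mass_sigma2 (R : realType) (F : finFieldType) (chi : F -> R[i])
    (d : nat) (E : {set 'rV[F]_d}) (m : 'rV[F]_d) :
  sphere_mass chi E (sqnorm m) = (#|F|%:R ^+ (2 * d) * sigma2 chi E m)%:C%C.
Proof.
have q_neq0 : (#|F|%:R : R[i]) != 0.
  by rewrite pnatr_eq0 -lt0n; apply/card_gt0P; exists 0.
rewrite rmorphM rmorph_sum mulr_sumr; apply: eq_bigr => m' _.
have -> : exp_sum chi E m' = #|F|%:R ^+ d * fourier chi E m'.
  by rewrite /fourier mulVKf ?expf_neq0.
rewrite normrM exprMn (complex_normE (fourier _ _ _)) !rmorphXn; congr (_ * _).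
by rewrite normrX normr_nat -exprM mulnC rmorph_nat.
Qed.

(** With M the minimum, M <= q and M P <= e^3, so multiplying the hypothesis by M
bounds both terms on the right by multiples of q e^4: they become at most
D q e^4 and A D q e^4. *)
Lemma min_le_of_energy_bound (R : realFieldType) (A q P e D : R) :
  0 < A -> 0 < q -> 0 < P -> 0 < e -> 0 <= D ->
  q * e ^+ 4 <= D * (e ^+ 4 + q * (A * P) * e) ->
  (1 + A)^-1 * Num.min q (e ^+ 3 / P) <= D.
Proof.
move=> A_gt0 q_gt0 P_gt0 e_gt0 D_ge0 energyD.
set M := Num.min q (e ^+ 3 / P).
have Mq : M <= q by rewrite ge_min lexx.
have MP : M * P <= e ^+ 3 by rewrite -ler_pdivlMr // ge_min lexx orbT.
have M_ge0 : 0 <= M.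
  by rewrite le_min !ltW // divr_gt0 ?exprn_gt0.
rewrite mulrC ler_pdivrMr; last by rewrite addr_gt0.
have qe_gt0 : 0 < q * e ^+ 4 by rewrite mulr_gt0 ?exprn_gt0.
rewrite -(ler_pM2l qe_gt0).
apply: le_trans (ler_wpM2r M_ge0 energyD) _.
have -> : D * (e ^+ 4 + q * (A * P) * e) * M
    = D * (e ^+ 4 * M + q * A * e * (M * P)) by ring.
have -> : q * e ^+ 4 * (D * (1 + A))
    = D * (e ^+ 4 * q + q * A * e * e ^+ 3) by ring.
apply: ler_wpM2l => //; apply: lerD; apply: ler_wpM2l => //.
  by rewrite exprn_ge0 // ltW.
by rewrite !mulr_ge0 // ltW.
Qed.

Theorem theorem1p11 (R : realType) (d : nat) (beta A : R) :
  (2 <= d)%N -> 0 < A ->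
  exists C : R, 0 < C /\
    forall (F : finFieldType) (chi : F -> R[i]) (E : {set 'rV[F]_d}),
      odd #|F| ->
      nontrivial_additive_character chi ->
      (forall m : 'rV[F]_d,
         `|sigma2 chi E m| <= A * #|F|%:R `^ (- beta)) ->
      C * Num.min (#|F|%:R : R)
                  (#|E|%:R ^+ 3 / #|F|%:R `^ (2 * d%:R - beta))
        <= #|distance_set E|%:R.
Proof.
move=> _ A_gt0; exists (1 + A)^-1; split; first by rewrite invr_gt0 addr_gt0.
move=> F chi E oddF [[chiD normc_chi] [t0 chi_t0]] sigma_le.
have q_gt0 : 0 < #|F|%:R :> R.
  by rewrite ltr0n; apply/card_gt0P; exists 0.
set P := #|F|%:R `^ (2 * d%:R - beta).
have PE : P = #|F|%:R ^+ (2 * d) * #|F|%:R `^ (- beta).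
  rewrite -powR_mulrn ?ltW // -powRD ?natrM //.
  by rewrite (gt_eqF q_gt0) implybT.
have P_gt0 : 0 < P by apply: powR_gt0.
have [->|/set0Pn E_neq0] := eqVneq E set0.
  rewrite cards0 expr0n mul0r (min_idPr _) ?mulr0 ?ler0n //.
apply: min_le_of_energy_bound => //.
  by rewrite ltr0n; apply/card_gt0P.
have sphere_mass_le r : sphere_mass chi E r <= (A * P)%:C%C.
  have [m /eqP <- | no_m] := pickP [pred m : 'rV[F]_d | sqnorm m == r].
    rewrite sphere_mass_sigma2 lecR PE mulrCA ler_wpM2l ?exprn_ge0 //.
    exact: le_trans (ler_norm _) (sigma_le m).
  (* No vector has this square norm, and the sum is empty. *)
  by rewrite /sphere_mass big_pred0 // ler0c ltW ?mulr_gt0.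
rewrite -lecR !(rmorphM, rmorphD, rmorphXn, rmorph_nat) -(rmorphM _ A).
apply: (card_distance_set_ge (chi := chi)) => //.
  by move=> t; rewrite complex_normE normc_chi.
by exists t0; apply/eqP.
Qed.
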